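(* Let $F$ be a nontrivial finite group and let $\tfrac12<p<1$. Let $R_n$ be the stationary random walk on the lamplighter group $F\wr\mathbb{Z}$ with parameter $p$. Then $R_n$ is recurrent if $p\ge\frac{|F|^2}{|F|^2+1}$, and transient if $p<\frac{|F|^2}{|F|^2+1}$.
   Context: Elements of $F\wr\mathbb{Z}$ are pairs $((L(i))_{i\in\mathbb{Z}},x)$ with $L:\mathbb{Z}\to F$ finitely supported (only finitely many $L(i)\neq \mathrm{id}_F$) and $x\in\mathbb{Z}$; the identity is the configuration with all lamps $\mathrm{id}_F$ and $x=0$. The stationary random walk with parameter $p$ is defined as follows. Let $(S_n)_{n\ge0}$ be the Markov chain on $\mathbb{Z}$ with $S_0=0$ and $\Pr(S_{n+1}=x+1\mid S_n=x)$ equal to $p$ if $x<0$, $\tfrac12$ if $x=0$, $1-p$ if $x>0$, and $\Pr(S_{n+1}=x-1\mid S_n=x)$ equal to $1-p$ if $x<0$, $\tfrac12$ if $x=0$, $p$ if $x>0$. Let $(U_n,V_n)_{n\ge1}$ be i.i.d. pairs of independent uniform random elements of $F$, independent of $(S_n)$. Set $L_0\equiv\mathrm{id}_F$ and $R_n=((L_n(i))_i,S_n)$, where $L_{n+1}(i)=L_n(i)$ if $i\notin\{S_n,S_{n+1}\}$, $L_{n+1}(S_n)=U_{n+1}$, and $L_{n+1}(S_{n+1})=V_{n+1}$. Recurrent means $R_n$ returns to the identity infinitely often almost surely; transient means it returns only finitely often almost surely. *)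

(* Defs.v *)
From HB Require Import structures.
From mathcomp Require Import all_boot all_order all_algebra all_fingroup.
From mathcomp Require Import all_classical all_reals all_analysis.
Set Implicit Arguments. Unset Strict Implicit. Unset Printing Implicit Defensive.
Import Order.TTheory GRing.Theory Num.Theory.
Local Open Scope ring_scope.

Definition stat_step {R : realType} (p : R) (x y : int) : R :=
  if y == x + 1 then (if x < 0 then p else if x == 0 then 1/2 else 1 - p)
  else if y == x - 1 then (if x < 0 then 1 - p else if x == 0 then 1/2 else p)
  else 0.

Fixpoint lamps {gT : finGroupType} (s : nat -> int) (u v : nat -> gT) (n : nat)
  : int -> gT :=
  match n with
  | 0 => fun _ => 1%g
  | m.+1 => fun i => if i == s m.+1 then v m.+1
                     else if i == s m then u m.+1
                     else lamps s u v m i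
  end.

(* R_n = ((L_n(i))_i, S_n) equals the identity of F wr Z. *)
Definition at_identity {gT : finGroupType} (s : nat -> int) (u v : nat -> gT)
  (n : nat) : Prop :=
  s n = 0 /\ forall i : int, lamps s u v n i = 1%g.

(* Main.v *)
(* Conditionally on the walk [S], the lamps visited before time [n] are
   independent and uniform, so [R_n] is the identity with probability
   [E (1_(S_n = 0) |F| ^ - |range S_n|)], and the range is an interval
   [-b .. a]. Summing over [n], everything reduces to the
   Green functions at [0] of [S] killed outside intervals. With
   [rho = p / (1 - p)], the function [rho ^ |x|] is harmonic away from [0], so
   the Green function of [-m .. m] is of order [rho ^ m], and that of
   [-b .. a] is at most of order [rho ^ min(a, b) <= sqrt rho ^ (a + b)].
   Hence the expected number of returns is infinite as soon as
   [sum_m |F| ^ (- 2 m) rho ^ m] diverges, that is when [|F| ^ 2 <= rho], and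
   it is finite as soon as [sum_(a, b) (sqrt rho / |F|) ^ (a + b)] converges,
   that is when [rho < |F| ^ 2].
   Finiteness gives transience by Borel-Cantelli. For recurrence, let [u_m] be
   the probability of being at the identity at time [m] and [e_N] that of no
   return during [N] steps: decomposing according to the last visit before
   time [N] gives [(sum_(m < N) u_m) e_N <= 1], so [e_N] tends to [0], and
   there is almost surely no last visit. *)
Require Import Defs.
From HB Require Import structures.
From mathcomp Require Import all_boot all_order all_algebra all_fingroup.
From mathcomp Require Import all_classical all_reals all_analysis.
From mathcomp Require Import zify ring lra.
Import Order.TTheory GRing.Theory Num.Theory.
Local Open Scope ring_scope.
Local Open Scope classical_set_scope.

(** * Nearest-neighbour paths in the integers and the size of their range *)

Definition nn : rel int := [rel x y | (y == x + 1) || (y == x - 1)].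

Lemma nn_neq x y : nn x y -> x != y.
Proof. by rewrite /nn /=; lia. Qed.

(** A starting point outside the hull of the rest of the path is adjacent to a point of that hull,
    so it lengthens the hull by exactly one integer while adding one new distinct point. *)
Lemma nn_path_hull x l : path nn x l -> exists lo hi : int,
  [/\ lo <= x <= hi, {in x :: l, forall z, lo <= z <= hi} &
      hi - lo + 1 <= (size (undup (x :: l)))%:Z].
Proof.
elim: l x => [|y l IH] x.
  move=> _; exists x, x; split => [|z|].
  - by rewrite !lexx.
  - by rewrite inE => /eqP ->; rewrite !lexx.
  - by rewrite subrr.
move=> /= /andP[xy /IH[lo [hi [yb lb sz]]]].
have [xb|xb] := boolP (lo <= x <= hi).
  exists lo, hi; split => // [z|].
    by rewrite inE => /predU1P[->//|]; exact: lb.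
  apply: le_trans sz _; rewrite lez_nat -/(undup (y :: l)).
  by case: ifP.
have xl : x \notin y :: l by apply: contra xb => /lb.
exists (Order.min lo x), (Order.max hi x); split => [|z|].
- by rewrite ge_min lexx orbT le_max lexx orbT.
- rewrite inE => /predU1P[->|/lb].
    by rewrite ge_min lexx orbT le_max lexx orbT.
  move=> /andP[? ?]; rewrite ge_min le_max.
  by apply/andP; split; apply/orP; left.
- rewrite (negbTE xl) [size _]/= -/(undup (y :: l)).
  move: sz yb xb xy; rewrite /nn /=; lia.
Qed.

Lemma uniq_absz_le (m : nat) (l : seq int) : uniq l ->
  {in l, forall x, absz x <= m}%N -> (size l <= m.*2.+1)%N.
Proof.
move=> ul lm.
rewrite -(size_iota 0 m.*2.+1) -(size_map (fun i : nat => i%:Z - m%:Z)).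
apply: uniq_leq_size => // x /lm xm.
by apply/mapP; exists (absz (x + m%:Z)); rewrite ?mem_iota; lia.
Qed.

(** * Green functions and exit times of the killed walk *)

Section Walk.
Context (R : realType) (p : R).
Implicit Types (x y : int) (f g : int -> R) (D : pred int).

Definition avg f x : R :=
  stat_step p x (x + 1) * f (x + 1) + stat_step p x (x - 1) * f (x - 1).

Lemma stat_step_up x :
  stat_step p x (x + 1) = if x < 0 then p else if x == 0 then 1/2 else 1 - p.
Proof. by rewrite /stat_step eqxx. Qed.

Lemma stat_step_down x :
  stat_step p x (x - 1) = if x < 0 then 1 - p else if x == 0 then 1/2 else p.
Proof. by rewrite /stat_step eqxx ifF//; lia. Qed.

Lemma avg_cst (c : R) x : avg (fun=> c) x = c.
Proof.
by rewrite /avg stat_step_up stat_step_down; do !case: ifP => _; field.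
Qed.

Lemma avg_sum (I : Type) (r : seq I) (P : pred I) (F : I -> int -> R) x :
  avg (fun y => \sum_(i <- r | P i) F i y) x =
  \sum_(i <- r | P i) avg (F i) x.
Proof. by rewrite /avg !mulr_sumr -big_split. Qed.

Lemma avgZ (c : R) f x : avg (fun y => c * f y) x = c * avg f x.
Proof. by rewrite /avg; ring. Qed.

Lemma avgD f g x : avg (fun y => f y + g y) x = avg f x + avg g x.
Proof. by rewrite /avg; ring. Qed.

Lemma avg_opp f x : avg f (- x) = avg (fun y => f (- y)) x.
Proof.
rewrite /avg !stat_step_up !stat_step_down opprD opprB oppr_lt0 oppr_eq0.
by rewrite (addrC 1 (- x)) [LHS]addrC; case: (ltrgt0P x) => [_|_|->].
Qed.

Lemma avg_abs (f : nat -> R) x : avg (f \o absz) x =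
  if x == 0 then f 1 else (1 - p) * f (absz x).+1 + p * f (absz x).-1.
Proof.
rewrite /avg stat_step_up stat_step_down /=; case: (ltrgt0P x) => [x0|x0|->].
- have [-> ->] : absz (x + 1) = (absz x).+1 /\
      absz (x - 1) = (absz x).-1 by lia.
  by [].
- have [-> ->] : absz (x + 1) = (absz x).-1 /\
      absz (x - 1) = (absz x).+1 by lia.
  by rewrite addrC.
- by rewrite add0r sub0r abszN absz1; field.
Qed.

(** Probability, from [x], of staying in [D] at the times [0..n] and being at [0] at time [n]. The
    sums over [n] are truncated Green functions. *)
Fixpoint killed D n x : R :=
  match n with
  | 0 => (D x && (x == 0))%:R
  | m.+1 => (D x)%:R * avg (killed D m) x
  end.

(** Probability, from [x], of staying in [D] at the times [0..n]. The sums over [n] are truncated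
    expected exit times. *)
Fixpoint surv D n x : R :=
  match n with
  | 0 => (D x)%:R
  | m.+1 => (D x)%:R * avg (surv D m) x
  end.

Lemma killed_out D n x : ~~ D x -> killed D n x = 0.
Proof. by move=> /negbTE Dx; case: n => [|n] /=; rewrite Dx// mul0r. Qed.

Lemma surv_out D n x : ~~ D x -> surv D n x = 0.
Proof. by move=> /negbTE Dx; case: n => [|n] /=; rewrite Dx// mul0r. Qed.

Lemma killed_opp D n x : killed D n (- x) = killed (fun y => D (- y)) n x.
Proof.
elim: n x => [|n IH] x /=; first by rewrite oppr_eq0.
by rewrite avg_opp /avg !IH.
Qed.

Lemma killed_sum_recl D N x : D x ->
  \sum_(n < N.+1) killed D n x =
  (x == 0)%:R + avg (fun y => \sum_(n < N) killed D n y) x.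
Proof.
move=> Dx; rewrite big_ord_recl /= Dx /= avg_sum; congr +%R.
by apply: eq_bigr => i _; rewrite mul1r.
Qed.

Hypotheses (p_gt : 1/2 < p) (p_lt : p < 1).

Lemma stat_step_ge0 x y : 0 <= stat_step p x y.
Proof.
by have := p_gt; have := p_lt; rewrite /stat_step; do !case: ifP => _; lra.
Qed.

Lemma ler_avg f g x : f (x + 1) <= g (x + 1) -> f (x - 1) <= g (x - 1) ->
  avg f x <= avg g x.
Proof. by move=> fg1 fg2; rewrite lerD// ler_wpM2l// stat_step_ge0. Qed.

Lemma avg_ge0 f x : (forall y, 0 <= f y) -> 0 <= avg f x.
Proof. by move=> f0; rewrite addr_ge0// mulr_ge0// stat_step_ge0. Qed.

Lemma killed_ge0 D n x : 0 <= killed D n x.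
Proof. by elim: n x => [|n IH] x //=; rewrite mulr_ge0// avg_ge0. Qed.

Lemma surv_ge0 D n x : 0 <= surv D n x.
Proof. by elim: n x => [|n IH] x //=; rewrite mulr_ge0// avg_ge0. Qed.

(** Comparison principle: passing from [N] to [N.+1] is one application of the first-step equation,
    which preserves the bound by a nonnegative supersolution. *)
Lemma sum_killed_le D f (f_ge0 : forall x, 0 <= f x)
    (super : forall x, D x -> (x == 0)%:R + avg f x <= f x) N x :
  \sum_(n < N) killed D n x <= f x.
Proof.
elim: N x => [|N IH] x; first by rewrite big_ord0.
have [Dx|Dx] := boolP (D x); last by rewrite big1 // => i _; rewrite killed_out.
by rewrite killed_sum_recl// (le_trans _ (super x Dx))// lerD2l ler_avg.
Qed.

Lemma surv_sum_le D f (f_ge0 : forall x, 0 <= f x)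
    (super : forall x, D x -> 1 + avg f x <= f x) N x :
  \sum_(n < N) surv D n x <= f x.
Proof.
elim: N x => [|N IH] x; first by rewrite big_ord0.
have [Dx|Dx] := boolP (D x); last by rewrite big1 // => i _; rewrite surv_out.
rewrite big_ord_recl /= Dx /= (le_trans _ (super x Dx))// lerD2l.
under eq_bigr do rewrite mul1r.
by rewrite -avg_sum ler_avg.
Qed.

Lemma surv_leS D n x : surv D n.+1 x <= surv D n x.
Proof.
elim: n x => [|n IH] x; last first.
  by rewrite /= ler_wpM2l// ler_avg// IH.
rewrite /= -[leRHS]mulr1 ler_wpM2l//.
by rewrite -[leRHS](avg_cst 1 x) ler_avg// lern1 leq_b1.
Qed.

Lemma surv_antitone D m n x : (m <= n)%N -> surv D n x <= surv D m x.
Proof.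
move=> /subnK <-; elim: (n - m)%N => [//|k IH].
by rewrite addSn (le_trans (surv_leS _ _ _)).
Qed.

(** Comparison from below. At a finite horizon the paths still alive in [D] have visits to come, and
    the term [c * surv D N x] pays for them. *)
Lemma sum_killed_ge D f (c : R) (c_ge0 : 0 <= c)
    (f_out : forall x, ~~ D x -> f x <= 0)
    (f_le : forall x, D x -> f x <= c)
    (sub : forall x, D x -> f x <= (x == 0)%:R + avg f x) N x :
  f x <= \sum_(n < N) killed D n x + c * surv D N x.
Proof.
have out M z : ~~ D z -> f z <= \sum_(n < M) killed D n z + c * surv D M z.
  move=> Dz; rewrite (le_trans (f_out z Dz))// addr_ge0//.
    by rewrite sumr_ge0// => i _; rewrite killed_ge0.
  by rewrite mulr_ge0// surv_ge0.
elim: N x => [|N IH] x; have [Dx|Dx] := boolP (D x); try exact: out.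
  by rewrite big_ord0 add0r /= Dx mulr1 f_le.
rewrite killed_sum_recl//= Dx mul1r -avgZ -addrA -avgD.
by rewrite (le_trans (sub x Dx))// lerD2l ler_avg// IH.
Qed.

Let rho := p / (1 - p).

Lemma rho_gt1 : 1 < rho.
Proof.
have := p_gt; have := p_lt => p1 p2.
by rewrite /rho ltr_pdivlMr; lra.
Qed.

Let p_rho : p = rho * (1 - p).
Proof. by rewrite /rho mulfVK// gt_eqF// subr_gt0. Qed.

Let p_rho1 : (1 - p) * (1 + rho) = 1.
Proof. by rewrite mulrDr mulr1 [_ * rho]mulrC -p_rho subrK. Qed.

(** [rho] is the root other than [1] of [(1 - p) * t ^+ 2 - t + p = 0]. *)
Lemma rho_harmonic n : (1 - p) * rho ^+ n.+2 + p * rho ^+ n = rho ^+ n.+1.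
Proof.
rewrite -[RHS]mul1r -[X in _ = X * _]p_rho1 [X in _ + X * _]p_rho !exprS; ring.
Qed.

(** From the negative side the walk drifts back to [0], so a barrier on the right alone makes the
    Green function finite, and further killing only lowers it. *)
Lemma green_le D (a N : nat) (Da : forall x, D x -> x <= a%:Z) :
  \sum_(n < N) killed D n 0 <= 2 / (rho - 1) * rho ^+ a.+1.
Proof.
have r1 := rho_gt1; have r0 : 0 < rho - 1 by rewrite subr_gt0.
have p0 := p_gt; have p1 := p_lt.
(* [f] is the Green function at [0] of the half-line [x <= a]. *)
pose phi n : R := 2 / (rho - 1) * (rho ^+ a.+1 - rho ^+ minn a.+1 n).
pose f x := phi (absz (Order.max x 0)).
have phi_ge0 n : 0 <= phi n.
  by rewrite mulr_ge0 ?divr_ge0 ?(ltW r0)// subr_ge0 ler_weXn2l ?geq_minl// ltW.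
have super x : D x -> (x == 0)%:R + avg f x <= f x.
  move=> /Da xa; rewrite /avg /f.
  case: (ltrgt0P x) => [x0|x0|->].
  - rewrite stat_step_up stat_step_down !ifF; try lia.
    have -> : absz (Order.max (x + 1) 0) = (absz x).+1 by lia.
    have -> : absz (Order.max (x - 1) 0) = (absz x).-1 by lia.
    case: (absz x) (ltac:(lia) : (0 < absz x <= a)%N) => // n /= na.
    rewrite /phi !(minn_idPr _) ?[(n <= _)%N]ltnW//; try lia.
    rewrite add0r le_eqVlt; apply/orP; left; apply/eqP.
    by rewrite -(rho_harmonic n); ring.
  - rewrite stat_step_up stat_step_down x0.
    have -> : absz (Order.max (x + 1) 0) = 0%N by lia.
    rewrite absz0.
    have -> : absz (Order.max (x - 1) 0) = 0%N by lia.
    by rewrite add0r -mulrDl subrKC mul1r.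
  - rewrite stat_step_up stat_step_down ltxx eqxx.
    have -> : absz (Order.max (0 + 1 : int) 0) = 1%N by lia.
    have -> : absz (Order.max (0 - 1 : int) 0) = 0%N by lia.
    rewrite /= /phi minn0 (minn_idPr _)// expr0 expr1.
    rewrite le_eqVlt; apply/orP; left; apply/eqP.
    by field; rewrite gt_eqF.
apply: le_trans (sum_killed_le D f (fun x => phi_ge0 _) super N 0) _.
rewrite /f /phi maxxx minn0 ler_wpM2l ?divr_ge0 ?(ltW r0)// gerBl.
by rewrite expr0.
Qed.

Lemma surv_small (m : nat) :
  exists N0, forall N, (N0 <= N)%N ->
    surv (fun x => absz x <= m)%N N 0 <= 1 / 2.
Proof.
have r1 := rho_gt1; have p0 := p_gt; have p1 := p_lt.
(* Since [la > rho], [la ^ |x|] is strictly subharmonic, so [phi \o absz] bounds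
   the expected exit time. *)
pose la := 2 * rho.
have la1 : 1 < la by rewrite /la; lra.
pose phi n : R := (la ^+ m.+1 - la ^+ minn m.+1 n) / ((la - 1) * p).
have c0 : 0 < (la - 1) * p by rewrite mulr_gt0 ?subr_gt0//; lra.
have phi_ge0 n : 0 <= phi n.
  by rewrite divr_ge0 ?(ltW c0)// subr_ge0 ler_weXn2l ?geq_minl// ltW.
have super x : (absz x <= m)%N -> 1 + avg (phi \o absz) x <= (phi \o absz) x.
  move=> xm; rewrite avg_abs /=; case: eqP => [->|/eqP x0].
    rewrite absz0 /phi minn0 (minn_idPr _)// expr0 expr1.
    rewrite -subr_ge0.
    have -> : (la ^+ m.+1 - 1) / ((la - 1) * p) -
      (1 + (la ^+ m.+1 - la) / ((la - 1) * p)) = (1 - p) / p.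
      by field; rewrite ?gt_eqF//; lra.
    by rewrite divr_ge0; lra.
  case: (absz x) (ltac:(lia) : (0 < absz x <= m)%N) => // n /= nm.
  rewrite /phi !(minn_idPr _) ?[(n <= _)%N]ltnW//; try lia.
  rewrite -subr_ge0.
  have -> : (la ^+ m.+1 - la ^+ n.+1) / ((la - 1) * p) -
     (1 + ((1 - p) * ((la ^+ m.+1 - la ^+ n.+2) / ((la - 1) * p)) +
     p * ((la ^+ m.+1 - la ^+ n) / ((la - 1) * p)))) =
     la ^+ n * (((1 - p) * la - p) / p) - 1.
    by rewrite !exprS; field; rewrite ?gt_eqF//; lra.
  (* The factor [2] in [la] is chosen for this identity: the surplus left in the inequality becomes
     [la ^+ n - 1]. *)
  have -> : (1 - p) * la - p = p by rewrite mulrC /la -mulrA -p_rho; ring.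
  rewrite divff ?gt_eqF//; last lra.
  by rewrite mulr1 subr_ge0 exprn_ege1// ltW.
(* As in Markov's inequality: survival decreases in time, so [N] times its value at [N] is at most
   the sum of the earlier values, hence at most [phi 0]. *)
exists (Num.trunc (2 * phi 0)).+1 => N HN.
have := surv_sum_le _ (phi \o absz) (fun x => phi_ge0 (absz x)) super N 0.
move=> H.
have N0 : 2 * phi 0 < N%:R.
  by rewrite (lt_le_trans (truncnS_gt _))// ler_nat.
have : N%:R * surv (fun x => absz x <= m)%N N 0 <= phi 0.
  apply: le_trans H; rewrite mulr_natl -[X in _ *+ X]card_ord -sumr_const.
  by apply: ler_sum => i _; rewrite surv_antitone// ltnW.
have := phi_ge0 0.
move: N0; set s := surv _ _ _; move: (phi 0) => t; move: (N%:R) => M ? ? ?.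
rewrite leNgt; apply/negP => s2. nra.
Qed.

(** The function [phi \o absz] below is harmonic away from [0], exceeds its average by exactly [1]
    at [0], and is nonpositive outside [[-m .. m]]. Waiting until survival drops to one half costs
    half of [phi 0], which is at least [rho ^+ m]. *)
Lemma green_ge (m : nat) :
  exists N0, forall N, (N0 <= N)%N ->
    rho ^+ m / 2 <= \sum_(n < N) killed (fun x => absz x <= m)%N n 0.
Proof.
have r1 := rho_gt1; have p0 := p_gt; have p1 := p_lt.
have r0 : 0 < rho - 1 by rewrite subr_gt0.
have [N0 HN0] := surv_small m; exists N0 => N /HN0 sN.
pose phi n : R := (rho ^+ m.+1 - rho ^+ n) / (rho - 1).
have phi0 : rho ^+ m <= phi 0.
  rewrite /phi expr0 ler_pdivlMr// mulrBr mulr1 -exprSr lerD2l lerN2.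
  by rewrite exprn_ege1// ltW.
have phi0_ge0 : 0 <= phi 0 by rewrite (le_trans _ phi0)// exprn_ge0//; lra.
suff : (phi \o absz) 0 <=
    \sum_(n < N) killed (fun x : int => (absz x <= m)%N) n 0 +
    phi 0 * surv (fun x : int => (absz x <= m)%N) N 0.
  rewrite /=.
  have : 0 <= phi 0 * (1 / 2 - surv (fun x => absz x <= m)%N N 0).
    by rewrite mulr_ge0// subr_ge0.
  by move: phi0; set a := phi 0; set b := rho ^+ m; set s := surv _ _ _; lra.
apply: sum_killed_ge => // x.
- rewrite -ltnNge => xm; rewrite /= /phi.
  by rewrite mulr_le0_ge0 ?invr_ge0 ?(ltW r0)// subr_le0 ler_weXn2l// ltW.
- move=> _; rewrite /= /phi ler_wpM2r ?invr_ge0 ?(ltW r0)//.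
  by rewrite lerD2l lerN2 expr0 exprn_ege1// ltW.
- move=> xm; rewrite avg_abs /=; case: eqP => [->|/eqP x0].
    rewrite absz0 /phi le_eqVlt; apply/orP; left; apply/eqP.
    by rewrite /= expr0 expr1; field; rewrite gt_eqF.
  have x1 : (0 < absz x)%N by rewrite absz_gt0.
  case: (absz x) x1 => // n _ /=.
  rewrite add0r /phi le_eqVlt; apply/orP; left; apply/eqP.
  by rewrite -(rho_harmonic n); ring.
Qed.

End Walk.

(** * Expectations over finite trajectories, with the lamps averaged out *)

Section Paths.
Context (R : realType) (p : R).
Implicit Types (x y : int) (l : seq int) (Psi : seq int -> R).

Notation avg := (avg R p).

(* Expectation of [Psi [:: x; S_1; ...; S_n]] for the walk started at [x]. *)
Fixpoint pathE n x Psi : R :=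
  match n with
  | 0 => Psi [:: x]
  | m.+1 => avg (fun y => pathE m y (fun l => Psi (x :: l))) x
  end.

Lemma eq_pathE n x Psi Psi' :
  (forall l, path nn x l -> size l = n -> Psi (x :: l) = Psi' (x :: l)) ->
  pathE n x Psi = pathE n x Psi'.
Proof.
elim: n x Psi Psi' => [|n IH] x Psi Psi' eq_Psi; first exact: eq_Psi.
rewrite /= /avg; congr (_ * _ + _ * _); apply: IH => l pl sl;
  by apply: eq_Psi; rewrite /= ?sl// pl andbT /nn /= eqxx ?orbT.
Qed.

Lemma pathE_sum (I : Type) (r : seq I) (P : pred I) (F : I -> seq int -> R)
    n x :
  pathE n x (fun l => \sum_(i <- r | P i) F i l) =
  \sum_(i <- r | P i) pathE n x (F i).
Proof.
elim: n x F => [//|n IH] x F /=.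
rewrite -avg_sum /avg; congr (_ * _ + _ * _);
  exact: (IH _ (fun i l => F i (x :: l))).
Qed.

Lemma pathEZ (c : R) n x Psi :
  pathE n x (fun l => c * Psi l) = c * pathE n x Psi.
Proof.
elim: n x Psi => [//|n IH] x Psi /=.
rewrite -avgZ /avg; congr (_ * _ + _ * _);
  exact: (IH _ (fun l => Psi (x :: l))).
Qed.

Lemma killedE (D : pred int) n x :
  killed R p D n x = pathE n x (fun l => (all D l && (last 0 l == 0))%:R).
Proof.
elim: n x => [|n IH] x /=; first by rewrite andbT.
rewrite -avgZ /avg; congr (_ * _ + _ * _); rewrite IH -pathEZ;
  by apply: eq_pathE => l _ _ /=; rewrite -natrM mulnb andbA.
Qed.

Context (gT : finGroupType).
Implicit Types (L : int -> gT) (phi : (int -> gT) -> int -> R).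
Local Notation q := (#|gT|%:R : R).

Definition relamp L x (u : gT) y (v : gT) : int -> gT :=
  fun i => if i == y then v else if i == x then u else L i.

(** Transition operator of the lamplighter chain; [w] holds the two fresh lamps, at the point of
    departure and at the point of arrival. *)
Definition lampStep phi L x : R :=
  \sum_(w : gT * gT)
    q^-1 ^+ 2 * avg (fun y => phi (relamp L x w.1 y w.2) y) x.

Definition isid L x : bool := (x == 0) && `[< forall i, L i = 1%g >].

(** Probability of being at the identity after [n] steps, as a function of an arbitrary initial
    state, so that first-step induction is available. *)
Definition ret n : (int -> gT) -> int -> R :=
  iter n lampStep (fun L x => (isid L x)%:R).

(* Conditionally on the trajectory [l] of the walker, the lamps on [l] are
   independent and uniform and the others are those of [L]. *)
Definition path_ret L l : R :=
  (last 0 l == 0)%:R * q^-1 ^+ size (undup l) *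
  (`[< forall i, i \notin l -> L i = 1%g >])%:R.

Let q_neq0 : q != 0.
Proof. by rewrite pnatr_eq0 -lt0n; apply/card_gt0P; exists 1%g. Qed.

Lemma sum_path_ret1 L x y : nn x y ->
  \sum_(w : gT * gT) q^-1 ^+ 2 * (isid (relamp L x w.1 y w.2) y)%:R =
  path_ret L [:: x; y].
Proof.
move=> /nn_neq xy.
have E w : isid (relamp L x w.1 y w.2) y =
    [&& w == (1%g, 1%g), y == 0 &
        `[< forall i, i \notin [:: x; y] -> L i = 1%g >]].
  rewrite /isid andbCA; congr (_ && _); case: w => u v /=.
  apply/asboolP/andP => [H|[/eqP[-> ->] /asboolP H] i].
    split.
      by move: (H x) (H y); rewrite /relamp eqxx (negbTE xy) eqxx => -> ->.
    apply/asboolP => i; rewrite !inE negb_or => /andP[/negbTE ix /negbTE iy].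
    by move: (H i); rewrite /relamp ix iy.
  rewrite /relamp; case: ifPn => // iy; case: ifPn => // ix.
  by apply: H; rewrite !inE negb_or ix.
rewrite (bigD1 (1%g, 1%g))// E eqxx big1 => [|w /negbTE w1]; last first.
  by rewrite E w1 mulr0.
rewrite [LHS]addr0 /path_ret /= inE (negbTE xy) /= -mulnb natrM.
by rewrite mulrA [X in X * _]mulrC.
Qed.

(** The lamp put at [y] is redrawn later, so its value is irrelevant. If the path revisits [x], so
    is the lamp put at [x]; otherwise that lamp is final, must be [1], and yields the extra factor
    [q^-1] for the new point [x]. *)
Lemma sum_path_ret L x y l :
  \sum_(w : gT * gT) q^-1 ^+ 2 * path_ret (relamp L x w.1 y w.2) (y :: l) =
  path_ret L (x :: y :: l).
Proof.
rewrite /path_ret -mulr_sumr /=; set U := undup (y :: l).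
have [xl|xl] := boolP (x \in y :: l).
  have E w : `[< forall i, i \notin y :: l -> relamp L x w.1 y w.2 i = 1%g >] =
      `[< forall i, i \notin x :: y :: l -> L i = 1%g >] :> bool.
    apply/asboolP/asboolP => H i il.
      have := H i; move: il; rewrite inE negb_or => /andP[ix il] /(_ il).
      by move: il; rewrite inE negb_or /relamp (negbTE ix) => /andP[/negbTE ->].
    have ix : i != x by apply: contraNneq il => ->.
    have iy : i != y by move: il; rewrite inE negb_or => /andP[].
    by rewrite /relamp (negbTE ix) (negbTE iy) H// inE negb_or ix.
  under eq_bigr do rewrite E.
  rewrite sumr_const card_prod -[_ *+ (_ * _)]mulr_natr natrM; field.
  exact: q_neq0.
have E w : `[< forall i, i \notin y :: l -> relamp L x w.1 y w.2 i = 1%g >] =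
    (w.1 == 1%g) && `[< forall i, i \notin x :: y :: l -> L i = 1%g >] :> bool.
  have xy : x != y by move: xl; rewrite inE negb_or => /andP[].
  apply/asboolP/andP => [H|[/eqP w1 /asboolP H] i il].
    split; first by move: (H x xl); rewrite /relamp eqxx (negbTE xy) => ->.
    apply/asboolP => i; rewrite inE negb_or => /andP[ix il].
    move: (H i il); rewrite /relamp (negbTE ix).
    by move: il; rewrite inE negb_or => /andP[/negbTE ->].
  have iy : i != y by move: il; rewrite inE negb_or => /andP[].
  rewrite /relamp (negbTE iy); case: ifPn => // ix.
  by rewrite H// inE negb_or ix.
under eq_bigr do rewrite E -mulnb natrM mulrCA.
rewrite -mulr_suml.
have -> : \sum_(w : gT * gT) (w.1 == 1%g)%:R = q.
  rewrite -(pair_bigA _ (fun u v : gT => (u == 1%g)%:R))/= (bigD1 1%g)//= eqxx.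
  rewrite sumr_const big1 ?addr0// => u /negbTE ->; exact: big1.
rewrite /= [in RHS]exprS expr2.
move: (last y l == 0)%:R (`[< _ >]%:R) (q^-1 ^+ size _) => a b c.
by field; exact: q_neq0.
Qed.

(** At least one step is required: at time [0] no lamp has been drawn, whereas [path_ret] would
    already charge [q^-1] for the starting point. *)
Lemma ret_pathE n L x : ret n.+1 L x = pathE n.+1 x (path_ret L).
Proof.
elim: n L x => [|n IH] L x.
  rewrite /ret /= /lampStep -mulr_sumr -avg_sum -avgZ /avg.
  by congr (_ * _ + _ * _); rewrite mulr_sumr sum_path_ret1// /nn /= eqxx ?orbT.
rewrite [LHS]/(lampStep (ret n.+1) L x) /lampStep -mulr_sumr -avg_sum -avgZ.
rewrite [RHS]/(avg (fun y => pathE n.+1 y _) x) /avg.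
by congr (_ * _ + _ * _); rewrite mulr_sumr;
  under eq_bigr do rewrite IH -pathEZ;
  rewrite -pathE_sum; apply: eq_pathE => l _ _; rewrite sum_path_ret.
Qed.

Hypotheses (p_gt : 1/2 < p) (p_lt : p < 1).

Lemma le_pathE n x Psi Psi' :
  (forall l, path nn x l -> size l = n -> Psi (x :: l) <= Psi' (x :: l)) ->
  pathE n x Psi <= pathE n x Psi'.
Proof.
elim: n x Psi Psi' => [|n IH] x Psi Psi' le_Psi; first exact: le_Psi.
by apply: ler_avg => //; apply: IH => l pl sl;
  apply: le_Psi; rewrite /= ?sl// pl andbT /nn /= eqxx ?orbT.
Qed.

End Paths.

(** * Sums of the return probabilities on either side of the threshold *)

Section ReturnSums.
Context (R : realType) (p : R) (gT : finGroupType).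
Hypotheses (p_gt : 1/2 < p) (p_lt : p < 1) (gT_gt1 : (1 < #|gT|)%N).
Local Notation q := (#|gT|%:R : R).
Local Notation rho := (p / (1 - p)).
Local Notation one := (fun _ : int => 1%g : gT).

Let q_gt1 : 1 < q. Proof. by rewrite ltr1n. Qed.
Let q_gt0 : 0 < q. Proof. exact: lt_trans ltr01 _. Qed.
Let qV_ge0 : 0 <= q^-1. Proof. by rewrite invr_ge0 ltW. Qed.

Lemma path_ret_one l :
  path_ret R gT one l = (last 0 l == 0)%:R * q^-1 ^+ size (undup l).
Proof.
rewrite /path_ret (_ : `[< _ >] = true :> bool) ?mulr1//.
exact/asboolP.
Qed.

Lemma ret0_one : ret R p gT 0 one 0 = 1.
Proof.
rewrite /ret /= /isid eqxx /= (_ : `[< _ >] = true :> bool)//.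
exact/asboolP.
Qed.

(** A path inside [[-m .. m]] has at most [2 m + 1] distinct points, and the series of
    [q^-1 ^+ m.*2.+1], multiplied by [1 - q^-1 ^+ 2], telescopes. This turns a weight depending on
    the range into a sum over fixed intervals. *)
Lemma path_ret_ge (K : nat) (l : seq int) : (0 < size l)%N ->
  (1 - q^-1 ^+ 2) * \sum_(m < K) q^-1 ^+ m.*2.+1 *
    (all (fun x => absz x <= m)%N l && (last 0 l == 0))%:R <=
  path_ret R gT one l.
Proof.
move=> l0; rewrite path_ret_one.
case: (last 0 l == 0); last first.
  by rewrite mul0r big1 ?mulr0// => m _; rewrite andbF mulr0.
rewrite mul1r; set s := size (undup l).
have q2 : 0 <= 1 - q^-1 ^+ 2.
  by rewrite subr_ge0 exprn_ile1// invf_le1// ltW.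
(* The telescoped remainder is kept on the right so that induction on [K] closes. *)
suff H : (1 - q^-1 ^+ 2) * \sum_(m < K) q^-1 ^+ m.*2.+1 * (s <= m.*2.+1)%:R <=
    (s <= K.*2.+1)%:R * (q^-1 ^+ s - q^-1 ^+ K.*2.+1).
  apply: (@le_trans _ _ ((s <= K.*2.+1)%:R * (q^-1 ^+ s - q^-1 ^+ K.*2.+1))).
    apply: le_trans H; apply: ler_wpM2l => //; apply: ler_sum => m _.
    rewrite ler_wpM2l ?exprn_ge0// andbT.
    case: allP => // lm; rewrite ler_nat lt0b uniq_absz_le ?undup_uniq// => x.
    by rewrite mem_undup => /lm.
  case: (s <= _)%N; rewrite ?mul0r ?mul1r ?exprn_ge0//.
  by rewrite gerBl exprn_ge0.
elim: K => [|K IH].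
  have s0 : (0 < s)%N.
    have : head 0 l \in undup l.
      by rewrite mem_undup; case: (l) l0 => //= x l' _; rewrite mem_head.
    by rewrite /s; case: (undup l).
  rewrite big_ord0 mulr0; case: leqP => [s1|_]; last by rewrite mul0r.
  by rewrite (_ : s = 1%N) ?subrr ?mulr0//; apply/eqP; rewrite eqn_leq s1.
rewrite big_ord_recr mulrDr /=; apply: le_trans (lerD IH (lexx _)) _.
have [sK|sK] := leqP s K.*2.+1.
  rewrite (_ : (s <= K.+1.*2.+1)%N = true); last by rewrite doubleS; lia.
  by rewrite doubleS !exprS le_eqVlt; apply/orP; left; apply/eqP; ring.
rewrite !mul0r !mulr0 add0r; case: leqP => sK2; rewrite ?mul0r ?mul1r//.
by rewrite subr_ge0 ler_wiXn2l// invf_le1// ltW.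
Qed.

Lemma ret_ge n :
  pathE R p n 0 (path_ret R gT one) <= ret R p gT n one 0.
Proof.
case: n => [|n]; last by rewrite ret_pathE.
by rewrite ret0_one /= path_ret_one /= ?eqxx mul1r expr1 invf_le1// ltW.
Qed.

Lemma ret_sum_unbounded (M : R) : q ^+ 2 <= rho ->
  exists N : nat, M <= \sum_(n < N) ret R p gT n one 0.
Proof.
move=> qrho.
pose D (m : nat) : pred int := fun x => (absz x <= m)%N.
pose c := (1 - q^-1 ^+ 2) * q^-1 / 2.
have q2 : 0 < 1 - q^-1 ^+ 2.
  by rewrite subr_gt0 exprn_ilt1// invf_lt1.
have c0 : 0 < c by rewrite divr_gt0// mulr_gt0// invr_gt0.
(* Each scale [m] contributes at least [q^-1 / 2], because [rho ^+ m] compensates [q^-1 ^+ m.*2];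
   equality [q ^+ 2 = rho] is enough. The horizon grows with the number of scales. *)
suff this : forall K : nat, exists N0 : nat, forall N, (N0 <= N)%N ->
    q^-1 / 2 *+ K <=
    \sum_(m < K) q^-1 ^+ m.*2.+1 * \sum_(n < N) killed R p (D m) n 0.
  have [N HN] := this (Num.trunc (M / c)).+1; exists N.
  have {}HN := HN N (leqnn N).
  apply: le_trans
    (_ : (1 - q^-1 ^+ 2) * (q^-1 / 2 *+ (Num.trunc (M / c)).+1) <= _).
    rewrite mulrnAr -[leRHS]mulr_natr !mulrA -/c.
    by rewrite -ler_pdivrMl// [leLHS]mulrC ltW// truncnS_gt.
  apply: le_trans (ler_wpM2l (ltW q2) HN) _.
  under eq_bigr do rewrite mulr_sumr.
  rewrite exchange_big mulr_sumr; apply: ler_sum => n _ /=.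
  apply: le_trans (ret_ge n).
  under eq_bigr do rewrite killedE// -pathEZ//.
  rewrite -pathE_sum// -pathEZ//; apply: le_pathE => // l _ _.
  exact: path_ret_ge.
elim=> [|K [N1 H1]]; first by exists 0%N => N _; rewrite big_ord0 mulr0n.
have [N2 H2] := green_ge R p p_gt p_lt K.
exists (maxn N1 N2) => N; rewrite geq_max => /andP[/H1 {}H1 /H2 {}H2].
rewrite mulrSr big_ord_recr /=; apply: lerD => //.
apply: le_trans (ler_wpM2l (exprn_ge0 _ qV_ge0) H2).
rewrite exprS -mulrA ler_wpM2l// mulrA -[leLHS]mul1r ler_wpM2r// -mul2n exprM.
by rewrite -exprMn exprn_ege1// exprVn ler_pdivlMl ?exprn_gt0// mulr1.
Qed.

(** One term of the double sum suffices: [[-b .. a]] is the hull of the path, which has at least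
    [a + b + 1] distinct points. The length bound puts [a] and [b] below [K]. *)
Lemma path_ret_le (K : nat) (l : seq int) : path nn 0 l -> (size l < K)%N ->
  path_ret R gT one (0 :: l) <=
  \sum_(a < K) \sum_(b < K) q^-1 ^+ (a + b) *
    (all (fun x => - b%:Z <= x <= a%:Z) (0 :: l) && (last 0 (0 :: l) == 0))%:R.
Proof.
move=> /nn_path_hull[lo [hi [/andP[lo0 hi0] lb sz]]] lK.
have sK : (size (undup (0%R :: l)) <= K)%N.
  by rewrite (leq_trans (size_undup _)).
have [hK lK'] : (absz hi < K)%N /\ (absz lo < K)%N.
  by move: sz sK lo0 hi0; set n := size _; clear; lia.
have term_ge0 (a b : nat) : 0 <= q^-1 ^+ (a + b) *
    (all (fun x => - b%:Z <= x <= a%:Z) (0 :: l) && (last 0 (0 :: l) == 0))%:R.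
  by rewrite mulr_ge0// exprn_ge0.
rewrite (bigD1 (Ordinal hK))//= ler_wpDr ?sumr_ge0// => [i _|].
  by rewrite sumr_ge0// => j _; exact: term_ge0.
rewrite (bigD1 (Ordinal lK'))//= ler_wpDr ?sumr_ge0//.
rewrite path_ret_one /= (_ : (- _ <= 0 <= _) && all _ _); last first.
  apply/andP; split; first by lia.
  by apply/allP => x xl; have := lb x; rewrite inE xl orbT => /(_ isT); lia.
rewrite mulrC ler_wpM2r// ler_wiXn2l ?invf_le1// ?(ltW q_gt1)//.
by move: sz; rewrite /=; lia.
Qed.

Lemma ret_sum_bounded : rho < q ^+ 2 ->
  exists C : R, forall N, \sum_(n < N) ret R p gT n one 0 <= C.
Proof.
move=> rhoq.
have rho1 := rho_gt1 R p p_gt p_lt.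
have rho0 : 0 < rho by rewrite (lt_trans ltr01).
pose s := Num.sqrt rho.
have s_ge1 : 1 <= s by rewrite -sqrtr1 ler_wsqrtr// ltW.
have s0 : 0 <= s by rewrite sqrtr_ge0.
have s2 n : rho ^+ n = s ^+ n.*2 by rewrite -mul2n exprM sqr_sqrtr// ltW.
pose t := s / q.
have t0 : 0 <= t by rewrite divr_ge0// ltW.
have t1 : t < 1.
  rewrite ltr_pdivrMr// mul1r -[ltRHS]ger0_norm ?(ltW q_gt0)// -sqrtr_sqr.
  by rewrite ltr_sqrt// exprn_gt0.
pose B := 2 / (rho - 1) * rho.
have B0 : 0 <= B by rewrite mulr_ge0 ?(ltW rho0)// divr_ge0// subr_ge0 ltW.
pose D (a b : nat) : pred int := fun x => - b%:Z <= x <= a%:Z.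
have G (a b N : nat) : \sum_(n < N) killed R p (D a b) n 0 <= B * s ^+ (a + b).
  have [ab|ba] := leqP a b.
    apply: le_trans (green_le R p p_gt p_lt (D a b) a N _) _.
      by move=> x /andP[].
    rewrite exprS mulrA ler_wpM2l// s2 ler_weXn2l//; clear -ab; lia.
  (* Reflection exchanges the two ends, so the half-line bound applies to the nearer one. *)
  under eq_bigr do rewrite -oppr0 killed_opp.
  apply: le_trans (green_le R p p_gt p_lt _ b N _) _.
    by move=> x; rewrite /D; clear; lia.
  rewrite exprS mulrA ler_wpM2l// s2 ler_weXn2l//; clear -ba; lia.
have geo N : \sum_(a < N) t ^+ a <= (1 - t)^-1.
  rewrite -[leRHS]mul1r ler_pdivlMr ?subr_gt0// mulrC -opprB mulNr -subrX1.
  by rewrite opprB gerBl exprn_ge0.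
exists (1 + B * ((1 - t)^-1 * (1 - t)^-1)) => N.
(* Time [0] is counted apart, and a path of fewer than [N] steps has a hull with both ends below [N]
   in absolute value. *)
have H n : (n < N)%N -> ret R p gT n one 0 <= (n == 0%N)%:R +
    \sum_(a < N) \sum_(b < N) q^-1 ^+ (a + b) * killed R p (D a b) n 0.
  case: n => [|n] nN.
    rewrite ret0_one lerDl sumr_ge0// => a _; rewrite sumr_ge0// => b _.
    by rewrite mulr_ge0 ?exprn_ge0 ?killed_ge0.
  rewrite add0r ret_pathE.
  under eq_bigr do under eq_bigr do rewrite killedE// -pathEZ//.
  under eq_bigr do rewrite -pathE_sum//.
  rewrite -pathE_sum//; apply: le_pathE => // l pl sl.
  by apply: path_ret_le => //; rewrite sl.
apply: (@le_trans _ _ (\sum_(n < N) ((n == 0%N :> nat)%:R + \sum_(a < N)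
    \sum_(b < N) q^-1 ^+ (a + b) * killed R p (D a b) n 0))).
  by apply: ler_sum => n _; exact: H.
rewrite big_split /=; apply: lerD.
  case: N {H} => [|N]; first by rewrite big_ord0.
  by rewrite big_ord_recl /= big1 ?addr0.
rewrite exchange_big /=; under eq_bigr do rewrite exchange_big /=.
apply: (@le_trans _ _ (\sum_(a < N) \sum_(b < N) B * (t ^+ a * t ^+ b))).
  apply: ler_sum => a _; apply: ler_sum => b _.
  rewrite -mulr_sumr.
  apply: le_trans (ler_wpM2l (exprn_ge0 _ qV_ge0) (G a b N)) _.
  by rewrite -exprD /t exprMn mulrCA [q^-1 ^+ _ * _]mulrC.
under eq_bigr do rewrite -mulr_sumr -mulr_sumr.
rewrite -mulr_sumr -mulr_suml ler_wpM2l// ler_pM//;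
  by rewrite sumr_ge0// => i _; rewrite exprn_ge0.
Qed.

End ReturnSums.

(** * Finite disjoint unions and partitions up to a null set *)

Lemma measure_bigsetU_fin (d : measure_display) (T : measurableType d)
    (R : realType) (mu : probability T R) (I : finType)
    (F : I -> set T) :
  (forall i, measurable (F i)) -> trivIset setT F ->
  mu (\big[setU/set0]_i F i) = (\sum_i mu (F i))%E.
Proof.
move=> mF tF; rewrite -!big_enum; elim: (enum I) (enum_uniq I) => [_|i r IH] /=.
  by rewrite !big_nil measure0.
move=> /andP[ir /IH {}IH]; rewrite !big_cons measureU//.
- by congr (_ + _)%E.
- exact: bigsetU_measurable.
rewrite big_distrr /= big_seq big1// => j jr.
by apply: (trivIsetP.1 tF) => //; apply: contraNneq ir => ->.
Qed.

(** The pieces carry the full measure of [C] without having to cover it. This fits cylinders refined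
    by a step of [1] or [-1], since other jumps are excluded only almost surely. *)
Lemma measure_setI_partition (d : measure_display) (T : measurableType d)
    (R : realType) (mu : probability T R) (I : finType)
    (C E : set T) (F : I -> set T) :
  measurable C -> measurable E -> (forall i, measurable (F i)) ->
  trivIset setT F -> (forall i, F i `<=` C) ->
  mu C = (\sum_i mu (F i))%E -> mu (C `&` E) = (\sum_i mu (F i `&` E))%E.
Proof.
move=> mC mE mF tF FC muC; pose U := \big[setU/set0]_i F i.
have mU : measurable U by exact: bigsetU_measurable.
have UC : U `<=` C.
  by rewrite /U; elim/big_ind : _ => // A B AC BC; rewrite subUset.
have CU0 : mu (C `\` U) = 0%E.
  have -> : mu (C `\` U) = (mu C - mu U)%E.
    by rewrite measureD// ?ltey_eq ?fin_num_measure// (setIidr UC).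
  by rewrite muC -measure_bigsetU_fin// subee// fin_num_measure.
have -> : C `&` E = (U `&` E) `|` ((C `\` U) `&` E).
  by rewrite -setIUl setDUK.
rewrite measureU0//; first last.
- apply: (subset_measure0 _ _ _ CU0).
    exact: measurableI (measurableD _ _) _.
    exact: measurableD.
  exact: subIsetl.
- exact: measurableI (measurableD _ _) _.
- exact: measurableI.
rewrite /U big_distrl /= measure_bigsetU_fin//.
- by move=> i; exact: measurableI.
- exact: trivIset_setIr.
Qed.

Lemma lamps_ext (gT : finGroupType) (s s' : nat -> int)
    (u u' v v' : nat -> gT) n :
  (forall k, (k <= n)%N -> s k = s' k) ->
  (forall k, (0 < k <= n)%N -> u k = u' k /\ v k = v' k) ->
  lamps s u v n = lamps s' u' v' n.
Proof.
elim: n => [//|n IH] ss uv; apply/funext => i /=.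
have [-> ->] := uv n.+1 (leqnn _).
rewrite !ss// IH// => k kn; first by rewrite ss// ltnW.
by apply: uv; case/andP: kn => -> /= /leqW.
Qed.

(** * Time-dependent constraints along the chain, and the Markov property at a last visit *)

Section Chain.
Context (R : realType) (p : R) (gT : finGroupType).
Local Notation q := (#|gT|%:R : R).
Local Notation one := (fun _ : int => 1%g : gT).
Local Notation lampStep := (lampStep R p gT).
Local Notation ret := (ret R p gT).
Local Notation isid := (isid gT).
Implicit Types (L : int -> gT) (G : nat -> (int -> gT) -> int -> bool).

(** Probability, from the state [(L, x)], that [G k] holds at each time [k <= n]. *)
Fixpoint follow n G L x : R :=
  match n with
  | 0 => (G 0 L x)%:R
  | m.+1 => (G 0 L x)%:R * lampStep (follow m (fun k => G k.+1)) L x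
  end.

(** Constraint at time [k] for the last visit to be at time [m]: nothing is asked before [m]. *)
Definition last_visit m k L x : bool :=
  ((k == m) ==> isid L x) && ((m < k)%N ==> ~~ isid L x).

Lemma eq_lampStep phi phi' L x : (forall L x, phi L x = phi' L x) ->
  lampStep phi L x = lampStep phi' L x.
Proof.
by move=> E; rewrite (_ : phi = phi')//; apply/funext => ?; apply/funext.
Qed.

Lemma lampStepZr phi (c : R) L x :
  lampStep (fun L x => phi L x * c) L x = lampStep phi L x * c.
Proof.
rewrite /lampStep mulr_suml; apply: eq_bigr => w _.
rewrite -[RHS]mulrA; congr (_ * _); rewrite [RHS]mulrC -avgZ /avg.
by congr (_ * _ + _ * _); rewrite mulrC.
Qed.

Lemma isid_one : isid one 0.
Proof. by rewrite /isid eqxx /=; exact/asboolP. Qed.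

Lemma isidP L x : reflect (x = 0 /\ forall i, L i = 1%g) (isid L x).
Proof.
rewrite /isid; apply: (iffP andP) => [[/eqP -> /asboolP]//|[-> H]].
by rewrite eqxx; split => //; exact/asboolP.
Qed.

(** Markov property: the first [m] steps are free and must end at the identity, from which the chain
    restarts and avoids it for [N] steps. *)
Lemma follow_last_visit m N L x : follow (m + N) (last_visit m) L x =
  ret m L x * follow N (last_visit 0) one 0.
Proof.
elim: m L x => [|m IH] L x.
  rewrite add0n /ret /=; case: (isidP L x) => [[-> L1]|Nid].
    by rewrite mul1r (_ : L = one)//; exact/funext.
  have Z : last_visit 0 0 L x = false.
    rewrite /last_visit eqxx implyTb; apply/negbTE; rewrite negb_and.
    by apply/orP; left; apply/negP => /isidP.
  by rewrite mul0r; case: N => [|N] /=; rewrite Z ?mul0r.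
rewrite addSn [LHS]/= mul1r.
have -> : ret m.+1 L x = lampStep (ret m) L x by [].
rewrite -lampStepZr; exact: eq_lampStep.
Qed.

Lemma follow0_one : follow 0 (last_visit 0) one 0 = 1.
Proof. by rewrite /= /last_visit /= isid_one. Qed.

End Chain.

(** * Probabilities of trajectory events, from the law of cylinders *)

Section Law.
Context (R : realType) (gT : finGroupType) (p : R).
Context (d : measure_display) (T : measurableType d) (P : probability T R).
Context (S : nat -> T -> int) (U V : nat -> T -> gT).
Hypotheses (mS : forall n x, measurable (S n @^-1` [set x]))
  (mU : forall n x, measurable (U n @^-1` [set x]))
  (mV : forall n x, measurable (V n @^-1` [set x])).
Local Notation q := (#|gT|%:R : R).
Local Notation one := (fun _ : int => 1%g : gT).
Local Notation lampsw n w := (lamps (S ^~ w) (U ^~ w) (V ^~ w) n).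
Implicit Types (s : nat -> int) (u v : nat -> gT)
  (G : nat -> (int -> gT) -> int -> bool).

Definition cyl n s u v : set T :=
  [set w | forall k, (k <= n)%N -> S k w = s k] `&`
  [set w | forall k, (0 < k <= n)%N -> U k w = u k /\ V k w = v k].

Definition path_weight n s : R :=
  (s 0%N == 0)%:R * \prod_(k < n) stat_step p (s k) (s k.+1) * q^-1 ^+ (2 * n).

Hypothesis law : forall n s u v, P (cyl n s u v) = (path_weight n s)%:E.

Definition followed m n G : set T :=
  [set w | forall k, (k <= n)%N -> G k (lampsw (m + k) w) (S (m + k)%N w)].

Lemma measurable_cyl n s u v : measurable (cyl n s u v).
Proof.
apply: measurableI.
  rewrite (_ : mkset _ =
      \bigcap_(k in [set k | (k <= n)%N]) (S k @^-1` [set s k])).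
    by apply: bigcap_measurableType => k _; exact: mS.
  by apply/seteqP; split => w /= H k /H.
rewrite (_ : mkset _ = \bigcap_(k in [set k | (0 < k <= n)%N])
    ((U k @^-1` [set u k]) `&` (V k @^-1` [set v k]))).
  by apply: bigcap_measurableType => k _; exact: measurableI.
by apply/seteqP; split => w /= H k /H.
Qed.

Lemma measurable_lamp n (i : int) (a : gT) :
  measurable [set w | lampsw n w i = a].
Proof.
elim: n => [|n IH] /=.
  have [->|/eqP a1] := eqVneq (1%g : gT) a.
    by rewrite (_ : mkset _ = setT)//; apply/seteqP; split.
  by rewrite (_ : mkset _ = set0)//; apply/seteqP; split.
rewrite (_ : mkset _ =
  (S n.+1 @^-1` [set i] `&` V n.+1 @^-1` [set a]) `|`
  (~` (S n.+1 @^-1` [set i]) `&`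
   ((S n @^-1` [set i] `&` U n.+1 @^-1` [set a]) `|`
    (~` (S n @^-1` [set i]) `&` [set w | lampsw n w i = a])))).
  by do ![apply: measurableU|apply: measurableI|apply: measurableC
         |exact: mS|exact: mU|exact: mV|exact: IH].
apply/seteqP; split => w /=.
  case: eqP => [-> ?|/nesym iS1]; first by left.
  case: eqP => [iS ?|/nesym iS ?]; first by right; split => //; left.
  by right; split => //; right.
case=> [[-> ->]|[/nesym/eqP/negbTE ->]]; first by rewrite eqxx.
by case=> [[-> ->]|[/nesym/eqP/negbTE -> ->]]; rewrite ?eqxx.
Qed.

Lemma measurable_isid n : measurable [set w | isid gT (lampsw n w) (S n w)].
Proof.
rewrite (_ : mkset _ = (S n @^-1` [set 0]) `&`
  \bigcap_k ([set w | lampsw n w k%:Z = 1%g] `&`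
             [set w | lampsw n w (- k%:Z) = 1%g])).
  apply: measurableI; first exact: mS.
  by apply: bigcapT_measurable => k; apply: measurableI; exact: measurable_lamp.
apply/seteqP; split => w /=.
  by move=> /isidP[-> H]; split => // k _; split; exact: H.
move=> [S0 H]; apply/isidP; split => // i.
by case: (H (absz i) Logic.I); case: (intP i) => [|k|k].
Qed.

Lemma measurable_last_visit m j k :
  measurable [set w | last_visit gT m k (lampsw j w) (S j w)].
Proof.
have mB := measurable_isid j.
pose b1 := (k == m); pose b2 := (m < k)%N.
rewrite /last_visit -/b1 -/b2; case: b1; case: b2 => /=.
- rewrite (_ : mkset _ = set0)//; apply/seteqP; split => // w /=.
  by case: (isid _ _ _).
- by under eq_set do rewrite andbT.
- rewrite (_ : mkset _ = ~` [set w | isid gT (lampsw j w) (S j w)]).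
    exact: measurableC.
  by apply/seteqP; split => w /= /negP.
- by rewrite (_ : mkset _ = setT)//; apply/seteqP; split.
Qed.

Lemma measurable_followed m n G :
  (forall k, measurable [set w | G k (lampsw (m + k) w) (S (m + k)%N w)]) ->
  measurable (followed m n G).
Proof.
move=> mG; rewrite (_ : followed m n G = \bigcap_(k in [set k | (k <= n)%N])
    [set w | G k (lampsw (m + k) w) (S (m + k)%N w)]).
  by apply: bigcap_measurableType => k _; exact: mG.
by apply/seteqP; split => w /= H k /H.
Qed.

Lemma cyl_state m s u v w : cyl m s u v w ->
  lampsw m w = lamps s u v m /\ S m w = s m.
Proof. by move=> [/= Ss UV]; split; [exact: lamps_ext|exact: Ss]. Qed.

Definition extend (A : Type) m (f : nat -> A) (a : A) : nat -> A :=
  fun k => if (k <= m)%N then f k else a.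

Lemma extend_le (A : Type) m (f : nat -> A) a k :
  (k <= m)%N -> extend A m f a k = f k.
Proof. by rewrite /extend => ->. Qed.

Lemma extend_gt (A : Type) m (f : nat -> A) a : extend A m f a m.+1 = a.
Proof. by rewrite /extend ltnn. Qed.

Let move (x : int) (b : bool) : int := if b then x + 1 else x - 1.

(** One-step refinements of a cylinder, indexed by the move and the two new lamps. *)
Let cylS m s u v (i : bool * (gT * gT)) : set T :=
  cyl m.+1 (extend _ m s (move (s m) i.1)) (extend _ m u i.2.1)
    (extend _ m v i.2.2).

Let cylS_sub m s u v i : cylS m s u v i `<=` cyl m s u v.
Proof.
move=> w [/= Ss UV]; split => /= k km.
  by rewrite Ss 1?leqW// /extend km.
case/andP: km => k0 km; have := UV k; rewrite k0 (leqW km) => /(_ isT).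
by rewrite /extend km.
Qed.

Let cylS_triv m s u v : trivIset setT (cylS m s u v).
Proof.
move=> [b [a1 a2]] [b' [a1' a2']] _ _ [w [[/= S1 UV1] [/= S2 UV2]]].
have := S1 m.+1 (leqnn _); have [] := UV1 m.+1 (leqnn _).
have := S2 m.+1 (leqnn _); have [] := UV2 m.+1 (leqnn _).
rewrite /extend ltnn => -> -> -> -> -> /eqP; clear.
by case: b b' => [] []; rewrite /move //=; lia.
Qed.

Let weight_cylS m s b :
  path_weight m.+1 (extend _ m s (move (s m) b)) =
  path_weight m s * stat_step p (s m) (move (s m) b) * q^-1 ^+ 2.
Proof.
rewrite /path_weight big_ord_recr /= extend_gt !extend_le//.
under eq_bigr => k _ do rewrite !extend_le// ?(ltnW (ltn_ord k))//.
by rewrite mulnS exprD; ring.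
Qed.

Let sum_cylS m s (phi : gT * gT -> int -> R) :
  \sum_(i : bool * (gT * gT)) path_weight m.+1 (extend _ m s (move (s m) i.1)) *
    phi i.2 (move (s m) i.1) =
  path_weight m s * \sum_(w : gT * gT) q^-1 ^+ 2 * avg R p (phi w) (s m).
Proof.
rewrite -(pair_bigA _ (fun b w =>
  path_weight m.+1 (extend _ m s (move (s m) b)) * phi w (move (s m) b))) /=.
rewrite exchange_big mulr_sumr; apply: eq_bigr => w _.
by rewrite big_bool !weight_cylS /avg /move /=; ring.
Qed.

(** Induction on the number of remaining steps: the cylinder splits, up to a null set, into its
    one-step refinements, whose weights reproduce [lampStep]. *)
Lemma prob_followed n m G s u v :
  (forall k, measurable [set w | G k (lampsw (m + k) w) (S (m + k)%N w)]) ->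
  P (cyl m s u v `&` followed m n G) =
  (path_weight m s * follow R p gT n G (lamps s u v m) (s m))%:E.
Proof.
elim: n m G s u v => [|n IH] m G s u v mG.
  rewrite /=; have [g0|g0] := boolP (G 0%N (lamps s u v m) (s m)).
    rewrite mulr1 -(law _ _ u v); congr (P _); apply: setIidl => w cw /= k.
    rewrite leqn0 => /eqP ->; rewrite addn0.
    by have [-> ->] := cyl_state _ _ _ _ _ cw.
  rewrite mulr0 (_ : _ `&` _ = set0) ?measure0//.
  apply/seteqP; split => // w [cw /= /(_ 0%N isT)]; rewrite addn0.
  by have [-> ->] := cyl_state _ _ _ _ _ cw; rewrite (negbTE g0).
have mE : measurable (followed m n.+1 G) by exact: measurable_followed.
rewrite (@measure_setI_partition _ _ _ P _ _ _ (cylS m s u v)) //; first last.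
- rewrite law; under eq_bigr do rewrite law.
  rewrite sumEFin; congr (_%:E).
  have := sum_cylS m s (fun _ _ => 1); under eq_bigr do rewrite mulr1.
  move=> ->; under eq_bigr do rewrite avg_cst mulr1.
  rewrite sumr_const card_prod -[_ *+ (_ * _)]mulr_natr natrM.
  have q0 : q != 0 by rewrite pnatr_eq0 -lt0n; apply/card_gt0P; exists 1%g.
  by field.
- by move=> i; exact: measurable_cyl.
- exact: measurable_cyl.
have mG' k :
  measurable [set w | G k.+1 (lampsw (m.+1 + k) w) (S (m.+1 + k)%N w)].
  by have := mG k.+1; rewrite addnS.
have E i : cylS m s u v i `&` followed m n.+1 G =
    if G 0%N (lamps s u v m) (s m) then
      cylS m s u v i `&` followed m.+1 n (fun k => G k.+1) else set0.
  case: ifPn => g0; apply/seteqP; split => w //.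
  - move=> [cw H]; split => //= k kn; rewrite addSnnS; exact: H.
  - move=> [cw H]; split => //= -[|k] kn; last by rewrite -addSnnS; exact: H.
    rewrite addn0.
    by have [-> ->] := cyl_state _ _ _ _ _ (cylS_sub _ _ _ _ _ _ cw).
  - move=> [cw /= /(_ 0%N isT)]; rewrite addn0.
    have [-> ->] := cyl_state _ _ _ _ _ (cylS_sub _ _ _ _ _ _ cw).
    by rewrite (negbTE g0).
under eq_bigr do rewrite E.
have [g0|g0] := boolP (G 0%N (lamps s u v m) (s m)); last first.
  by rewrite /= (negbTE g0) mul0r mulr0 big1// => i _; rewrite measure0.
under eq_bigr do rewrite IH//.
rewrite sumEFin /= g0 mul1r; congr (_%:E).
rewrite -sum_cylS; apply: eq_bigr => -[b [a1 a2]] _ /=.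
rewrite extend_gt; congr (_ * follow _ _ _ _ _ _ _).
apply/funext => i; rewrite /relamp /extend leqnn ltnn.
case: ifP => // _; case: ifP => // _; congr (_ _).
by apply: lamps_ext => k; [move=> -> | case/andP => _ ->].
Qed.

(** * Visits to the identity: last visits, then recurrence and transience *)

Let s0 : nat -> int := fun=> 0.
Let one_seq : nat -> gT := fun=> 1%g.
Let start : set T := cyl 0 s0 one_seq one_seq.
Local Notation esc N := (follow R p gT N (last_visit gT 0) one 0).
Local Notation u_ n := (ret R p gT n one 0).
Local Notation at_id n := [set w | at_identity (S ^~ w) (U ^~ w) (V ^~ w) n].

Definition last_visit_upto m N : set T :=
  start `&` followed 0 (m + N) (last_visit gT m).

Lemma measurable_last_visit_upto m N : measurable (last_visit_upto m N).
Proof.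
apply: measurableI; first exact: measurable_cyl.
by apply: measurable_followed => k; exact: measurable_last_visit.
Qed.

Lemma prob_last_visit_upto m N : P (last_visit_upto m N) = (u_ m * esc N)%:E.
Proof.
rewrite prob_followed; last by move=> k; exact: measurable_last_visit.
by rewrite follow_last_visit /path_weight /s0 eqxx big_ord0 muln0 expr0 !mul1r.
Qed.

Lemma prob_start : P start = 1%E.
Proof. by rewrite law /path_weight /s0 eqxx big_ord0 muln0 expr0 !mulr1. Qed.

Lemma prob_startC : P (~` start) = 0%E.
Proof.
by rewrite probability_setC ?prob_start ?subee//; exact: measurable_cyl.
Qed.

Lemma at_idP n w : reflect (at_identity (S ^~ w) (U ^~ w) (V ^~ w) n)
  (isid gT (lampsw n w) (S n w)).
Proof. exact: isidP. Qed.

Lemma measurable_at_id n : measurable (at_id n).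
Proof.
rewrite (_ : at_id n = [set w | isid gT (lampsw n w) (S n w)]).
  exact: measurable_isid.
by apply/seteqP; split => w /= /at_idP.
Qed.

Lemma last_visit_uptoP m N w : last_visit_upto m N w <->
  [/\ start w, at_identity (S ^~ w) (U ^~ w) (V ^~ w) m &
      forall k, (m < k <= m + N)%N ->
        ~ at_identity (S ^~ w) (U ^~ w) (V ^~ w) k].
Proof.
split=> [[sw H]|[sw Hm H]].
  split => //.
    have := H m (leq_addr _ _).
    by rewrite add0n /last_visit eqxx => /andP[/at_idP].
  move=> k /andP[mk kN] /at_idP Hk.
  by have := H k kN; rewrite add0n /last_visit mk Hk andbF.
split => //= k kN; rewrite add0n; apply/andP; split; apply/implyP.
  by move=> /eqP ->; exact/at_idP.
by move=> mk; apply/negP => /at_idP; apply: H; rewrite mk.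
Qed.

Lemma prob_at_id n : P (start `&` at_id n) = (u_ n)%:E.
Proof.
rewrite -[u_ n]mulr1 -(follow0_one R p gT) -prob_last_visit_upto.
congr (P _); apply/seteqP; split => w.
  by move=> [sw nw]; apply/last_visit_uptoP; split => // k; lia.
by move=> /last_visit_uptoP[].
Qed.

Lemma esc_ge0 N : 0 <= esc N.
Proof.
have := prob_last_visit_upto 0 N; rewrite /= isid_one mul1r => H.
by rewrite -lee_fin -H.
Qed.

Lemma esc_antitone M N : (M <= N)%N -> esc N <= esc M.
Proof.
move=> MN; have H K : P (last_visit_upto 0 K) = (esc K)%:E.
  by rewrite prob_last_visit_upto /= isid_one mul1r.
rewrite -lee_fin -!H le_measure ?inE//; do ?exact: measurable_last_visit_upto.
move=> w /last_visit_uptoP[sw w0 H0]; apply/last_visit_uptoP; split => // k.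
by move=> /andP[k0 kM]; apply: H0; lia.
Qed.

(* Decomposing according to the last visit to the identity before time [N]. *)
Lemma sum_ret_esc_le1 N : (\sum_(m < N) u_ m) * esc N <= 1.
Proof.
pose F (m : 'I_N) := last_visit_upto m (N - m).
have mF m : measurable (F m) by exact: measurable_last_visit_upto.
have tF : trivIset setT F.
  move=> i j _ _ [w [/last_visit_uptoP[_ iw Hi] /last_visit_uptoP[_ jw Hj]]].
  apply/val_inj; case: (ltngtP i j) => // ij; exfalso.
    by apply: Hi jw; have := ltn_ord j; lia.
  by apply: Hj iw; have := ltn_ord i; lia.
have : (P (\big[setU/set0]_i F i) <= 1)%E.
  by apply: probability_le1; exact: bigsetU_measurable.
rewrite measure_bigsetU_fin// /F.
under eq_bigr do rewrite prob_last_visit_upto.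
rewrite sumEFin lee_fin; apply: le_trans.
rewrite mulr_suml; apply: ler_sum => m _.
apply: ler_wpM2l; last exact/esc_antitone/leq_subr.
by rewrite -lee_fin -prob_at_id.
Qed.

Lemma measurable_io :
  measurable [set w | forall m, exists n, (m <= n)%N /\ at_id n w].
Proof.
rewrite (_ : mkset _ = \bigcap_m \bigcup_(n in [set n | (m <= n)%N]) at_id n).
  apply: bigcapT_measurable => m; apply: bigcup_measurable => n _.
  exact: measurable_at_id.
apply/seteqP; split => w H m; first by move=> _; have [n []] := H m; exists n.
by have [n mn nw] := H m Logic.I; exists n.
Qed.

Lemma prob_io_recurrent :
  (forall M, exists N : nat, M <= \sum_(n < N) u_ n) ->
  P [set w | forall m, exists n, (m <= n)%N /\ at_id n w] = 1%E.
Proof.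
move=> div; set io := [set w | _].
have mio : measurable io := measurable_io.
have esc0 e : 0 < e -> exists N, esc N <= e.
  move=> e0; have [N HN] := div e^-1; exists N.
  have le1 := sum_ret_esc_le1 N.
  have : e^-1 * esc N <= 1 by apply: le_trans le1; rewrite ler_wpM2r// esc_ge0.
  by rewrite ler_pdivrMl// mulr1.
(* [A m] is the event that the visit at time [m] is the last one ever. *)
pose A m := \bigcap_N last_visit_upto m N.
have mA m : measurable (A m).
  by apply: bigcapT_measurable => N; exact: measurable_last_visit_upto.
have A0 m : P (A m) = 0%E.
  apply/eqP; rewrite eq_le measure_ge0 andbT; apply/lee_addgt0Pr => e e0.
  rewrite add0e; have [N HN] := esc0 _ e0.
  apply: (@le_trans _ _ (P (last_visit_upto m N))).
    rewrite le_measure ?inE//; first exact: measurable_last_visit_upto.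
    by move=> w; apply.
  rewrite prob_last_visit_upto lee_fin; apply: le_trans HN.
  rewrite -[leRHS]mul1r ler_wpM2r ?esc_ge0//.
  rewrite -lee_fin -prob_at_id probability_le1//.
  by apply: measurableI; [exact: measurable_cyl|exact: measurable_at_id].
have ioN : P (~` io) = 0%E.
  apply: measure_negligible; first exact: measurableC.
  apply: (@negligibleS _ _ _ P (~` start `|` \bigcup_m A m)); last first.
    apply: negligibleU.
      apply/negligibleP; first by apply: measurableC; exact: measurable_cyl.
      exact: prob_startC.
    by apply: negligible_bigcup => m; apply/negligibleP; [exact: mA|exact: A0].
  move=> w nio; have [sw|] := pselect (start w); last by left.
  right; have [m0 Hm0] : exists m, forall n, (m <= n)%N -> ~ at_id n w.
    apply: contrapT => H; apply: nio; rewrite /io /= => m.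
    apply: contrapT => H'.
    by apply: H; exists m => n mn nw; apply: H'; exists n.
  pose b n := isid gT (lampsw n w) (S n w).
  (* The visit at time [0] ensures that a largest visit time exists when there are finitely many. *)
  have b0 : exists n, b n.
    exists 0%N; apply/at_idP; split => //; case: sw => /= sw _.
    exact: sw.
  have bm n : b n -> (n <= m0)%N.
    by move=> /at_idP bn; rewrite leqNgt; apply/negP => /ltnW /Hm0.
  case: (ex_maxnP b0 bm) => m /at_idP mw mmax; exists m => // N _.
  apply/last_visit_uptoP; split => // k /andP[mk _] /at_idP /mmax.
  by rewrite leqNgt mk.
by rewrite -[io]setCK probability_setC ?ioN ?sube0//; exact: measurableC.
Qed.

Lemma prob_io_transient (C : R) : (forall N, \sum_(n < N) u_ n <= C) ->
  P [set w | forall m, exists n, (m <= n)%N /\ at_id n w] = 0%E.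
Proof.
move=> bnd; have mio := measurable_io.
pose F n := start `&` at_id n.
have mF n : measurable (F n).
  by apply: measurableI; [exact: measurable_cyl|exact: measurable_at_id].
have sumF : (\sum_(n <oo) P (F n) < +oo)%E.
  apply: (@le_lt_trans _ _ C%:E); last exact: ltry.
  apply: lime_le; first exact: is_cvg_nneseries.
  near=> N; rewrite big_mkord; under eq_bigr do rewrite prob_at_id.
  by rewrite sumEFin lee_fin.
apply: measure_negligible => //.
apply: (@negligibleS _ _ _ P (~` start `|` lim_sup_set F)); last first.
  apply: negligibleU.
    apply/negligibleP; first by apply: measurableC; exact: measurable_cyl.
    exact: prob_startC.
  apply/negligibleP; last exact: lim_sup_set_cvg0.
  by apply: bigcapT_measurable => m; apply: bigcup_measurable.
move=> w iow; have [sw|] := pselect (start w); last by left.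
by right => m _; have [n [mn nw]] := iow m; exists n.
Unshelve. all: by end_near.
Qed.

End Law.

Theorem theorem1p1 (R : realType) (gT : finGroupType) (p : R)
  (hF : (1 < #|gT|)%N) (hp1 : 1/2 < p) (hp2 : p < 1)
  (d : measure_display) (T : measurableType d) (P : probability T R)
  (S : nat -> T -> int) (U V : nat -> T -> gT)
  (mS : forall n x, measurable (S n @^-1` [set x]))
  (mU : forall n x, measurable (U n @^-1` [set x]))
  (mV : forall n x, measurable (V n @^-1` [set x]))
  (law : forall (n : nat) (s : nat -> int) (u v : nat -> gT),
     P ([set w | forall k, (k <= n)%N -> S k w = s k] `&`
        [set w | forall k, (0 < k <= n)%N -> U k w = u k /\ V k w = v k])
     = (((s 0%N == 0)%:R * \prod_(k < n) stat_step p (s k) (s k.+1)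
          * (#|gT|%:R ^-1) ^+ (2 * n)) : R)%:E) :
  let io := [set w | forall m : nat, exists n : nat,
               (m <= n)%N /\ at_identity (S ^~ w) (U ^~ w) (V ^~ w) n] in
  (#|gT|%:R ^+ 2 / (#|gT|%:R ^+ 2 + 1) <= p -> P io = 1%E) /\
  (p < #|gT|%:R ^+ 2 / (#|gT|%:R ^+ 2 + 1) -> P io = 0%E).
Proof.
move=> io.
have q2 : 0 < #|gT|%:R ^+ 2 + 1 :> R by rewrite ltr_wpDl// exprn_ge0.
(* Both sides say [q ^+ 2 * (1 - p) <= p], with [q] the order of the group. *)
have E : (#|gT|%:R ^+ 2 / (#|gT|%:R ^+ 2 + 1) <= p) =
    (#|gT|%:R ^+ 2 <= p / (1 - p)).
  rewrite ler_pdivrMr// ler_pdivlMr ?subr_gt0//.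
  by apply/idP/idP => ?; lra.
split => [|]; rewrite ?ltNge E -?ltNge => H.
  apply: (prob_io_recurrent R gT p d T P S U V) => // M.
  exact: ret_sum_unbounded.
have [C HC] := ret_sum_bounded R p gT hp1 hp2 hF H.
exact: (prob_io_transient R gT p d T P S U V mS mU mV law C).
Qed.
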